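(* For every positive integer $n$, \[ \mathcal{A}_n(u,v;x_1,\ldots,x_n)=\frac{\det_{1\le i,j\le n}\big(x_i^{\,n-j}p_j(x_i)\big)}{\prod_{1\le i<j\le n}(x_i-x_j)},\qquad p_j(x)=\sum_{k=0}^{j-1}x^k(-1+u+v-ux)^k v^{\,j-1-k}. \]
   Context: $\mathrm{ASym}_{x_1,\ldots,x_n} f=\sum_{\sigma\in S_n}\mathrm{sgn}(\sigma) f(x_{\sigma(1)},\ldots,x_{\sigma(n)})$, and \[ \mathcal{A}_n(u,v;x_1,\ldots,x_n)=\frac{\mathrm{ASym}_{x_1,\ldots,x_n}\Big[\prod_{i=1}^n x_i^{i-1}\prod_{1\le i<j\le n}\big(v+(1-u-v)x_i+u x_i x_j\big)\Big]}{\prod_{1\le i<j\le n}(x_j-x_i)}. \] *)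

(* Defs.v *)
From HB Require Import structures.
From mathcomp Require Import all_boot all_order all_algebra all_fingroup.
Set Implicit Arguments. Unset Strict Implicit. Unset Printing Implicit Defensive.
Import Order.TTheory GRing.Theory Num.Theory.
Local Open Scope ring_scope.

(* Indices are 0-based: x : 'I_n -> R, x i corresponds to x_{i+1}. *)

Definition ASym (R : comNzRingType) (n : nat) (f : ('I_n -> R) -> R) (x : 'I_n -> R) : R :=
  \sum_(s : 'S_n) (-1) ^+ (odd_perm s) * f (fun i => x (s i)).

Definition prod_lt (R : comNzRingType) (n : nat) (F : 'I_n -> 'I_n -> R) : R :=
  \prod_(i < n) \prod_(j < n | (i < j)%N) F i j.

Definition A_summand (R : comNzRingType) (n : nat) (u v : R) (x : 'I_n -> R) : R :=
  (\prod_(i < n) x i ^+ i) *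
  prod_lt (fun i j => v + (1 - u - v) * x i + u * x i * x j).

Definition vandermonde_rev (R : comNzRingType) (n : nat) (x : 'I_n -> R) : R :=
  prod_lt (fun i j => x j - x i).

Definition cA (R : fieldType) (n : nat) (u v : R) (x : 'I_n -> R) : R :=
  ASym (A_summand u v) x / vandermonde_rev x.

(* p_j(x) = sum_{k=0}^{j-1} x^k (-1+u+v-ux)^k v^{j-1-k}, j 1-based *)
Definition p_poly (R : comNzRingType) (u v : R) (j : nat) (y : R) : R :=
  \sum_(k < j) y ^+ k * (-1 + u + v - u * y) ^+ k * v ^+ (j - 1 - k).

Definition det_matrix (R : comNzRingType) (n : nat) (u v : R) (x : 'I_n -> R) : 'M[R]_n :=
  \matrix_(i < n, j < n) (x i ^+ (n - j.+1) * p_poly u v j.+1 (x i)).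

(* Main.v *)
Require Import Defs.
From HB Require Import structures.
From mathcomp Require Import all_boot all_order all_algebra all_fingroup.
From mathcomp Require Import ring zify.
Import GRing.Theory.
Set Implicit Arguments. Unset Strict Implicit.
Local Open Scope ring_scope.

(* Put y_j := -1 + u + v - u x_j.  Then v + (1-u-v) x_i + u x_i x_j = v - x_i y_j,
   so the numerator of A_n is the two-alphabet antisymmetrisation
     asym2 v x y = sum_s sgn(s) prod_i x_(s i)^i prod_(i<j) (v - x_(s i) y_(s j)),
   in which x and y are permuted simultaneously, while p_j(x_i) = h_(j-1)(v, x_i y_i)
   where h_r(v,t) = sum_k v^(r-k) t^k is the complete homogeneous polynomial.
   The heart of the file is the identity, valid over any commutative ring,
     asym2 v x y = det (x_i^j h_(n-1-j)(v, x_i y_i))_(i,j)          (asym2_det)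
   proved by induction on n: expanding asym2 according to the image j of the first
   position gives n+1 terms, each equal to a cofactor of the first column of the
   matrix times a fixed linear combination of the entries of row j.  This comes from
   the generating polynomial E(w) = prod_k (1 - w_k X) of the elementary symmetric
   functions, through prod_k (v - a w_k) = sum_m [(1 - bX) E(w)]_m a^m h_(n-m)(v,ab)
   (prod_linear_hsum); the cofactor identity adj(A) A = det(A) then collapses the sum.
   The theorem follows by reversing the order of the columns of the determinant and
   of the Vandermonde product, which produces the same sign on both sides. *)

Section ElementarySymmetric.
Variable R : comNzRingType.

Definition hsum (r : nat) (v t : R) : R := \sum_(k < r.+1) v ^+ (r - k) * t ^+ k.

Lemma hsum0 (v t : R) : hsum 0 v t = 1.
Proof. by rewrite /hsum big_ord1 !expr0 mulr1. Qed.

Lemma hsumS (r : nat) (v t : R) : hsum r.+1 v t = v ^+ r.+1 + t * hsum r v t.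
Proof.
rewrite /hsum big_ord_recl subn0 expr0 mulr1; congr (_ + _).
by rewrite mulr_sumr; apply: eq_bigr => k _; rewrite lift0 subSS exprS; ring.
Qed.

(* prod_k (1 - w_k X): its m-th coefficient is (-1)^m e_m(w). *)
Definition elem_poly (n : nat) (w : 'I_n -> R) : {poly R} :=
  \prod_(k < n) (1 - w k *: 'X).

Lemma coef_linear_factorM (c : R) (p : {poly R}) (m : nat) :
  ((1 - c *: 'X) * p)`_m = p`_m - c * (if m is m'.+1 then p`_m' else 0).
Proof. by rewrite mulrBl mul1r coefB -scalerAl coefZ coefXM; case: m. Qed.

Lemma elem_poly_lift (n : nat) (w : 'I_n.+1 -> R) (j : 'I_n.+1) :
  elem_poly w = (1 - w j *: 'X) * elem_poly (fun k => w (lift j k)).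
Proof. by rewrite /elem_poly (bigD1_ord j). Qed.

Lemma elem_poly_coef0 (n : nat) (w : 'I_n -> R) : (elem_poly w)`_0 = 1.
Proof.
elim: n w => [|n IH] w; first by rewrite /elem_poly big_ord0 coef1.
by rewrite (elem_poly_lift _ ord0) coef_linear_factorM IH mulr0 subr0.
Qed.

Lemma elem_poly_coef_gt (n : nat) (w : 'I_n -> R) (m : nat) :
  (n < m)%N -> (elem_poly w)`_m = 0.
Proof.
elim: n w m => [|n IH] w m Hm; first by rewrite /elem_poly big_ord0 coef1; case: m Hm.
rewrite (elem_poly_lift _ ord0) coef_linear_factorM; case: m Hm => [//|m] Hm.
by rewrite !IH ?mulr0 ?subr0 // ltnW.
Qed.

Lemma elem_poly_homog (n : nat) (w : 'I_n -> R) (a v : R) :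
  \sum_(m < n.+1) (elem_poly w)`_m * a ^+ m * v ^+ (n - m) = \prod_(k < n) (v - a * w k).
Proof.
elim: n w => [|n IH] w; first by rewrite big_ord1 big_ord0 elem_poly_coef0 !expr0 !mulr1.
rewrite big_ord_recl -IH (elem_poly_lift _ ord0).
under eq_bigr do rewrite coef_linear_factorM !mulrBl.
rewrite sumrB mulrBl !mulr_sumr; congr (_ - _).
  rewrite big_ord_recr /= elem_poly_coef_gt // !mul0r addr0.
  apply: eq_bigr => i _; rewrite /= subSn ?exprS; last by rewrite -ltnS.
  ring.
rewrite big_ord_recl /= mulr0 !mul0r add0r.
by apply: eq_bigr => i _; rewrite /bump /= add0n add1n subSS exprS; ring.
Qed.

Lemma prod_linear_hsum (n : nat) (w : 'I_n -> R) (a b v : R) :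
  \prod_(k < n) (v - a * w k) =
  \sum_(m < n.+1) ((1 - b *: 'X) * elem_poly w)`_m * a ^+ m * hsum (n - m) v (a * b).
Proof.
rewrite -elem_poly_homog; set E := elem_poly w.
under [RHS]eq_bigr do rewrite coef_linear_factorM !mulrBl.
rewrite sumrB [X in _ = X - _]big_ord_recr [X in _ = _ - X]big_ord_recl.
rewrite [LHS]big_ord_recr /= subnn hsum0 expr0 !mulr0 !mul0r add0r.
rewrite addrAC; congr (_ + _); rewrite -sumrB; apply: eq_bigr => i _.
rewrite /bump /= add0n add1n -{2}(subnSK (ltn_ord i)) hsumS (subnSK (ltn_ord i)) exprS.
ring.
Qed.

End ElementarySymmetric.

Section TwoAlphabetAntisymmetrisation.
Variable R : comNzRingType.

Definition asym2_summand (n : nat) (v : R) (x y : 'I_n -> R) : R :=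
  (\prod_(i < n) x i ^+ i) * \prod_(i < n) \prod_(j < n | (i < j)%N) (v - x i * y j).

Definition asym2 (n : nat) (v : R) (x y : 'I_n -> R) : R :=
  \sum_(s : 'S_n) (-1) ^+ s * asym2_summand v (fun i => x (s i)) (fun i => y (s i)).

Lemma eq_asym2_summand (n : nat) (v : R) (x y x' y' : 'I_n -> R) :
  x =1 x' -> y =1 y' -> asym2_summand v x y = asym2_summand v x' y'.
Proof.
move=> Ex Ey; rewrite /asym2_summand; congr (_ * _).
  by apply: eq_bigr => i _; rewrite Ex.
by apply: eq_bigr => i _; apply: eq_bigr => j _; rewrite Ex Ey.
Qed.

Lemma prod_ord_recl_cond (n : nat) (P : pred nat) (F : 'I_n.+1 -> R) :
  \prod_(j < n.+1 | P j) F j =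
  (if P 0%N then F ord0 else 1) * \prod_(j < n | P j.+1) F (lift ord0 j).
Proof. by rewrite big_mkcond big_ord_recl [in RHS]big_mkcond. Qed.

Lemma asym2_summand_recl (n : nat) (v : R) (x y : 'I_n.+1 -> R) :
  asym2_summand v x y =
  (\prod_(k < n) (v - x ord0 * y (lift ord0 k))) * (\prod_(k < n) x (lift ord0 k)) *
  asym2_summand v (fun k => x (lift ord0 k)) (fun k => y (lift ord0 k)).
Proof.
rewrite /asym2_summand big_ord_recl [X in _ * X]big_ord_recl expr0 mul1r.
rewrite prod_ord_recl_cond /= mul1r.
have -> : \prod_(i < n) x (lift ord0 i) ^+ lift ord0 i =
          (\prod_(k < n) x (lift ord0 k)) * \prod_(i < n) x (lift ord0 i) ^+ i.
  by rewrite -big_split; apply: eq_bigr => i _; rewrite lift0 exprS.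
have -> : \prod_(i < n) \prod_(j < n.+1 | (lift ord0 i < j)%N)
              (v - x (lift ord0 i) * y j) =
          \prod_(i < n) \prod_(j < n | (i < j)%N)
              (v - x (lift ord0 i) * y (lift ord0 j)).
  apply: eq_bigr => i _; rewrite prod_ord_recl_cond ltn0 mul1r.
  by apply: eq_bigl => j; rewrite lift0 ltnS.
under eq_bigl do rewrite ltn0Sn.
by rewrite /=; ring.
Qed.

(* Every permutation of 'I_n.+1 is uniquely lift_perm ord0 j t, with j its value
   at ord0 and t : 'S_n. *)
Lemma sum_perm_lift (n : nat) (G : 'S_n.+1 -> R) :
  \sum_(s : 'S_n.+1) G s = \sum_(j < n.+1) \sum_(t : 'S_n) G (lift_perm ord0 j t).
Proof.
rewrite (partition_big (fun s : 'S_n.+1 => s ord0) predT) //=.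
apply: eq_bigr => j _; rewrite (reindex (lift_perm ord0 j)); last first.
  pose unlift_at (s : 'S_n.+1) k := odflt k (unlift (s ord0) (s (lift ord0 k))).
  have unlift_atK (s : 'S_n.+1) k : lift (s ord0) (unlift_at s k) = s (lift ord0 k).
    rewrite /unlift_at; have := neq_lift ord0 k.
    by rewrite -(can_eq (permK s)) => /unlift_some[] ? ? ->.
  have inj_unlift_at (s : 'S_n.+1) : injective (unlift_at s).
    apply: can_inj (fun k => odflt k (unlift ord0 (s^-1%g (lift (s ord0) k)))) _ => k.
    by rewrite unlift_atK permK liftK.
  exists (fun s => perm (inj_unlift_at s)) => [t _ | s].
    by apply/permP => k; rewrite permE /unlift_at lift_perm_lift lift_perm_id liftK.
  move/(s _ =P _) => s0; apply/permP => k.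
  case: (unliftP ord0 k) => [k'|] ->; rewrite ?lift_perm_id //.
  by rewrite lift_perm_lift -s0 permE unlift_atK.
by apply: eq_bigl => t; rewrite lift_perm_id eqxx.
Qed.

Lemma asym2_expand (n : nat) (v : R) (x y : 'I_n.+1 -> R) :
  asym2 v x y = \sum_(j < n.+1) (-1) ^+ j *
     (\prod_(k < n) (v - x j * y (lift j k))) * (\prod_(k < n) x (lift j k)) *
     asym2 v (fun k => x (lift j k)) (fun k => y (lift j k)).
Proof.
rewrite /asym2 sum_perm_lift; apply: eq_bigr => j _.
rewrite mulr_sumr; apply: eq_bigr => t _.
rewrite asym2_summand_recl /= lift_perm_id.
under eq_bigr do rewrite lift_perm_lift.
under [X in _ * (_ * X * _)]eq_bigr do rewrite lift_perm_lift.
rewrite (@eq_asym2_summand _ v _ _ (fun k => x (lift j (t k))) (fun k => y (lift j (t k))));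
  try by move=> k; rewrite /= lift_perm_lift.
have reperm (F : 'I_n -> R) : \prod_(k < n) F (t k) = \prod_(k < n) F k.
  by rewrite [RHS](reindex_inj (@perm_inj _ t)).
rewrite (reperm (fun k => v - x j * y (lift j k))) (reperm (fun k => x (lift j k))).
rewrite odd_lift_perm /= signr_addb signr_odd -!mulrA; congr (_ * _).
by rewrite mulrCA; congr (_ * _); rewrite mulrCA.
Qed.

End TwoAlphabetAntisymmetrisation.

Section HomogeneousDeterminant.
Variable R : comNzRingType.

Definition hmatrix (n : nat) (v : R) (x y : 'I_n -> R) : 'M[R]_n :=
  \matrix_(i, j) (x i ^+ j * hsum (n.-1 - j) v (x i * y i)).

Lemma hmatrix_cofactor (n : nat) (v : R) (x y : 'I_n.+1 -> R) (j : 'I_n.+1) :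
  cofactor (hmatrix v x y) j ord0 = (-1) ^+ j * (\prod_(k < n) x (lift j k)) *
     \det (hmatrix v (fun k => x (lift j k)) (fun k => y (lift j k))).
Proof.
rewrite /cofactor addn0 -mulrA; congr (_ * _).
have -> : row' j (col' ord0 (hmatrix v x y)) =
   diag_mx (\row_k x (lift j k)) *m hmatrix v (fun k => x (lift j k)) (fun k => y (lift j k)).
  apply/matrixP => k l; rewrite mul_diag_mx !mxE lift0 exprS /=.
  by rewrite (_ : (n - l.+1 = n.-1 - l)%N) ?mulrA //; lia.
by rewrite det_mulmx det_diag; congr (_ * _); apply: eq_bigr => k _; rewrite mxE.
Qed.

Lemma cofactor_combination (n : nat) (A : 'M[R]_n) (c : 'I_n -> R) (j0 : 'I_n) :
  \sum_(i < n) (\sum_(m < n) c m * A i m) * cofactor A i j0 = c j0 * \det A.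
Proof.
under eq_bigr do rewrite mulr_suml.
rewrite exchange_big /=.
under eq_bigr do (under eq_bigr do rewrite -mulrA; rewrite -mulr_sumr).
have col_cofactor m : \sum_(i < n) A i m * cofactor A i j0 = \det A *+ (j0 == m).
  have := congr1 (fun B : 'M[R]_n => B j0 m) (mul_adj_mx A).
  by rewrite !mxE => <-; apply: eq_bigr => i _; rewrite [(\adj _) _ _]mxE mulrC.
under eq_bigr do rewrite col_cofactor.
rewrite (bigD1 j0) //= eqxx mulr1n big1 ?addr0 // => m.
by rewrite eq_sym => /negPf ->; rewrite mulr0n mulr0.
Qed.

Lemma asym2_expand_term (n : nat) (v : R) (x y : 'I_n.+1 -> R) (j : 'I_n.+1) :
  (-1) ^+ j * (\prod_(k < n) (v - x j * y (lift j k))) * (\prod_(k < n) x (lift j k)) *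
     \det (hmatrix v (fun k => x (lift j k)) (fun k => y (lift j k))) =
  (\sum_(m < n.+1) (elem_poly y)`_m * hmatrix v x y j m) *
     cofactor (hmatrix v x y) j ord0.
Proof.
rewrite hmatrix_cofactor (prod_linear_hsum _ _ (y j)) -elem_poly_lift.
under [in RHS]eq_bigr do rewrite mxE /= mulrA.
set a := (-1) ^+ _; set P := \prod_(k < n) _; set D := \det _.
by rewrite -!mulrA mulrCA.
Qed.

Theorem asym2_det (n : nat) (v : R) (x y : 'I_n -> R) :
  asym2 v x y = \det (hmatrix v x y).
Proof.
elim: n x y => [|n IH] x y.
  by rewrite /asym2 /asym2_summand /determinant; apply: eq_bigr => s _; rewrite !big_ord0 mulr1.
rewrite asym2_expand.
under eq_bigr do rewrite IH asym2_expand_term.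
by rewrite cofactor_combination elem_poly_coef0 mul1r.
Qed.

End HomogeneousDeterminant.

Section Specialisation.
Variable R : comNzRingType.

Lemma det_col_perm (n : nat) (s : 'S_n) (A : 'M[R]_n) :
  \det (col_perm s A) = (-1) ^+ s * \det A.
Proof. by rewrite col_permE det_mulmx det_perm odd_permV mulrC. Qed.

Lemma prod_lt_rev (n : nat) (F : 'I_n -> 'I_n -> R) :
  prod_lt (fun i j => F (rev_ord j) (rev_ord i)) = prod_lt F.
Proof.
rewrite /prod_lt (reindex_inj rev_ord_inj) /=.
under eq_bigr => i _ do rewrite (reindex_inj rev_ord_inj) /= rev_ordK.
transitivity (\prod_(i < n) \prod_(j < n | (j < i)%N) F j i).
  apply: eq_bigr => i _; apply: eq_big => j; last by rewrite rev_ordK.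
  by move: (ltn_ord i) (ltn_ord j) => Hi Hj; apply/idP/idP; lia.
by rewrite (exchange_big_dep xpredT).
Qed.

Lemma prod_lt_sign (n : nat) (x : 'I_n -> R) :
  prod_lt (fun i j => x i - x j) = (-1) ^+ (perm (@rev_ord_inj n)) * vandermonde_rev x.
Proof.
have rev_Vandermonde : Vandermonde n (\row_j x (rev_ord j)) =
    col_perm (perm (@rev_ord_inj n)) (Vandermonde n (\row_j x j)).
  by apply/matrixP => i j; rewrite !mxE permE.
have := det_Vandermonde (\row_j x (rev_ord j)).
rewrite rev_Vandermonde det_col_perm det_Vandermonde => Vrev.
have -> : vandermonde_rev x = \prod_(i < n) \prod_(j < n | (i < j)%N)
    ((\row_k x k) 0 j - (\row_k x k) 0 i).
  by apply: eq_bigr => i _; apply: eq_bigr => j _; rewrite !mxE.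
rewrite Vrev -prod_lt_rev.
by apply: eq_bigr => i _; apply: eq_bigr => j _; rewrite !mxE.
Qed.

Variables (u v : R).

(* The alphabet y_j = -1 + u + v - u x_j for which v - x_i y_j is the factor of A_n. *)
Definition dual_alphabet (n : nat) (x : 'I_n -> R) (i : 'I_n) : R := -1 + u + v - u * x i.

Lemma ASym_asym2 (n : nat) (x : 'I_n -> R) : ASym (A_summand u v) x = asym2 v x (dual_alphabet x).
Proof.
rewrite /ASym /asym2; apply: eq_bigr => s _; congr (_ * _).
rewrite /A_summand /asym2_summand /prod_lt; congr (_ * _).
by apply: eq_bigr => i _; apply: eq_bigr => j _; rewrite /dual_alphabet; ring.
Qed.

(* p_j(x_i) = h_(j-1)(v, x_i y_i): the frozen matrix is hmatrix with reversed columns. *)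
Lemma det_matrix_hmatrix (n : nat) (x : 'I_n -> R) :
  det_matrix u v x = col_perm (perm (@rev_ord_inj n)) (hmatrix v x (dual_alphabet x)).
Proof.
apply/matrixP => i j; rewrite !mxE permE /=; congr (_ * _).
rewrite (_ : (n.-1 - (n - j.+1) = j)%N); last by have := ltn_ord j; lia.
rewrite /p_poly /hsum subn1; apply: eq_bigr => k _.
by rewrite /dual_alphabet exprMn; ring.
Qed.

End Specialisation.

Theorem mainTheorem4 (R : fieldType) (n : nat) (u v : R) (x : 'I_n -> R) :
  (0 < n)%N -> injective x ->
  cA u v x = \det (det_matrix u v x) / prod_lt (fun i j => x i - x j).
Proof.
move=> _ _.
rewrite /cA ASym_asym2 asym2_det det_matrix_hmatrix det_col_perm prod_lt_sign.
have sign_neq0 : (-1) ^+ perm (@rev_ord_inj n) != 0 :> R by rewrite signr_eq0.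
by rewrite invfM mulrACA mulfV // mul1r.
Qed.
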